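(* Let $c \in \mathbb{R}^n$, let $\mathcal{L} \subseteq \mathbb{R}^n$ be a subspace and let $\mathcal{K} = \mathcal{K}^1 \times \mathcal{K}^2 \subseteq \mathbb{R}^n$ be a closed convex cone such that $\mathcal{K}^2$ is polyhedral. Then $(\mathcal{L}+c)\cap \left( (\mathrm{ri}\, \mathcal{K}^1) \times \mathcal{K}^2 \right) = \emptyset$ if and only if one of the conditions below holds: (a) there exists $x \in \mathcal{K}^* \cap \mathcal{L}^\perp$ such that $\langle c, x\rangle < 0$; (b) there exists $x = (x_1,x_2) \in \mathcal{K}^* \cap \mathcal{L}^\perp \cap \{c\}^\perp$ such that $x_1 \notin (\mathcal{K}^1)^\perp$.
   Context: Here $\mathcal{K}^1\subseteq\mathbb{R}^{n_1}$, $\mathcal{K}^2\subseteq\mathbb{R}^{n_2}$ are (nonempty) closed convex cones, $n=n_1+n_2$, and vectors $x\in\mathbb{R}^n$ are split accordingly as $x=(x_1,x_2)$. The inner product on $\mathbb{R}^n$ is $\langle\cdot,\cdot\rangle$; $\mathrm{ri}$ is the relative interior; $\mathcal{K}^*=\{s : \langle s,x\rangle\ge 0\ \forall x\in\mathcal{K}\}$ is the dual cone; for a set $\mathcal{U}$, $\mathcal{U}^\perp$ is the subspace of vectors orthogonal to all elements of $\mathcal{U}$ (so $(\mathcal{K}^1)^\perp\subseteq\mathbb{R}^{n_1}$). *)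

(* Defs.v *)
From HB Require Import structures.
From mathcomp Require Import all_boot all_order all_algebra.
From mathcomp Require Import all_classical all_reals all_analysis.

Set Implicit Arguments.
Unset Strict Implicit.
Unset Printing Implicit Defensive.

Import Order.TTheory GRing.Theory Num.Theory.
Import numFieldNormedType.Exports.

Local Open Scope classical_set_scope.
Local Open Scope ring_scope.

(* R^n is 'rV[R]_n with its library topology (sup norm), which is the usual
   one; x : 'rV[R]_(n1 + n2) splits as (lsubmx x, rsubmx x). *)

Definition dot (R : realType) (n : nat) (x y : 'rV[R]_n) : R :=
  \sum_(i < n) x ord0 i * y ord0 i.

Definition closed_convex_cone (R : realType) (n : nat)
    (K : set 'rV[R]_n) : Prop :=
  [/\ K !=set0, closed K,
      convex_set (K : set (convex_lmodType 'rV[R]_n)) &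
      forall (a : R) (x : 'rV[R]_n), 0 <= a -> K x -> K (a *: x)].

(* The half-spaces are allowed to be affine, and their number m may be 0. *)
Definition polyhedral (R : realType) (n : nat) (K : set 'rV[R]_n) : Prop :=
  exists (m : nat) (a : 'I_m -> 'rV[R]_n) (b : 'I_m -> R),
    K = [set x | forall i, dot (a i) x <= b i].

Definition dual_cone (R : realType) (n : nat) (K : set 'rV[R]_n) :
    set 'rV[R]_n :=
  [set s | forall x, K x -> 0 <= dot s x].

Definition orth (R : realType) (n : nat) (U : set 'rV[R]_n) : set 'rV[R]_n :=
  [set s | forall x, U x -> dot s x = 0].

Definition affine_hull (R : realType) (n : nat) (K : set 'rV[R]_n) :
    set 'rV[R]_n :=
  [set x | exists (m : nat) (a : 'I_m -> R) (p : 'I_m -> 'rV[R]_n),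
    [/\ \sum_(i < m) a i = 1, forall i, K (p i) &
        x = \sum_(i < m) a i *: p i]].

Definition relint (R : realType) (n : nat) (K : set 'rV[R]_n) :
    set 'rV[R]_n :=
  [set x | K x /\ within (affine_hull K) (nbhs x) K].

Definition prod_set (R : realType) (n1 n2 : nat)
    (A : set 'rV[R]_n1) (B : set 'rV[R]_n2) : set 'rV[R]_(n1 + n2) :=
  [set x | A (lsubmx x) /\ B (rsubmx x)].

(* Main.v *)
(* Let V be the span of K1, and let Q be the set of z1 in V with (z1, z2) in
   L + c and z2 in K2, so that emptiness of the intersection means that Q misses
   ri K1. If Q is empty, Farkas' lemma yields (a). Otherwise homogenize Q to a
   cone H; the cone K1 - H does not contain -e, where e in ri K1 is the sum of a
   finite family of elements of K1 spanning V and hence an order unit of V. The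
   M. Riesz extension theorem gives v with <v, e> = 1, v >= 0 on K1 and v <= 0
   on H. Since H is cut out by linear equations and inequalities, Farkas' lemma
   lifts v to an x in L^perp with x1 = v on V, x2 in K2^* and <c, x> <= 0, which
   is (a) or (b). *)
Require Import Defs.
From mathcomp Require Import all_boot all_order all_algebra.
From mathcomp Require Import all_classical all_reals all_analysis.
From mathcomp Require Import lra ring.

Import Order.TTheory GRing.Theory Num.Theory.
Import numFieldNormedType.Exports.

Local Open Scope classical_set_scope.
Local Open Scope ring_scope.

(** * Farkas' lemma for finitely many linear forms *)

(** Induction on the family. If the implication fails without [a j], at [z0] say, the induction
    hypothesis is applied to the forms composed with a projection onto the kernel of [a j]. Since
    [r] has no repetition, the weight at [j] can be chosen freely. *)
Lemma farkas_seq (R : realFieldType) (E : lmodType R) (I : eqType) (r : seq I)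
    (a : I -> E -> R) (u : E -> R) :
  uniq r -> (forall i, scalar (a i)) -> scalar u ->
  (forall z, (forall i, i \in r -> 0 <= a i z) -> 0 <= u z) ->
  exists2 w : I -> R, forall i, 0 <= w i &
    forall z, u z = \sum_(i <- r) w i * a i z.
Proof.
elim: r a u => [|j r IHr] a u /= ur ha hu H.
  (* Without constraints [u] is nonnegative at [z] and at [- z], hence zero. *)
  exists (fun=> 0) => // z; rewrite big_nil.
  have u0 : u 0 = 0 by have := hu (-1) 0 0; rewrite /= scaler0 addr0; lra.
  have /= := hu (-1) z 0; rewrite addr0 u0 => uN.
  have uz : 0 <= u z by exact: H.
  have : 0 <= u (-1 *: z) by exact: H.
  by rewrite uN; lra.
case/andP: ur => jr ur.
have sum_j (w : I -> R) (k : R) z :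
    \sum_(i <- j :: r) (if i == j then k else w i) * a i z =
    k * a j z + \sum_(i <- r) w i * a i z.
  rewrite big_cons eqxx; congr (_ + _); apply: eq_big_seq => i ir.
  by case: eqP => // ij; rewrite ij (negbTE jr) in ir.
have [Hr|] := pselect (forall z, (forall i, i \in r -> 0 <= a i z) -> 0 <= u z).
  have [w w_ge0 uE] := IHr a u ur ha hu Hr.
  exists (fun i => if i == j then 0 else w i) => [i|z]; first by case: ifP.
  by rewrite sum_j mul0r add0r.
move=> /existsNP[z0 /not_implyP[az0 /negP]]; rewrite -ltNge => uz0.
have ajz0 : a j z0 < 0.
  rewrite ltNge; apply/negP => ajz0.
  suff : 0 <= u z0 by rewrite leNgt uz0.
  by apply: H => i; rewrite inE => /predU1P[->//|/az0].
(* Projecting along [z0] onto the kernel of [a j] eliminates the constraint. *)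
pose p z := z + (- a j z / a j z0) *: z0.
have fp (f : E -> R) z : scalar f -> f (p z) = f z + (- a j z / a j z0) * f z0.
  by move=> hf; rewrite /p addrC hf /= addrC.
have hp (f : E -> R) : scalar f -> scalar (f \o p).
  move=> hf k x y; rewrite /= !fp// hf /= (ha j) /=.
  by field; apply: ltr0_neq0.
have [|||w w_ge0 uE] := IHr (fun i => a i \o p) (u \o p) ur.
- by move=> i; exact: hp.
- exact: hp.
- move=> z apz; apply: H => i; rewrite inE => /predU1P[->|/apz//].
  by rewrite fp// divfK ?subrr// ltr0_neq0.
set s := \sum_(i <- r) w i * a i z0.
have s_ge0 : 0 <= s by rewrite /s big_seq sumr_ge0// => i ir; rewrite mulr_ge0 ?az0.
(* The weight at [j] is forced by the identity at [z0]. It is nonnegative because [u z0 < 0 <= s]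
   and [a j z0 < 0]. *)
exists (fun i => if i == j then (u z0 - s) / a j z0 else w i) => [i|z].
  by case: ifP => // _; rewrite ler_ndivlMr// mul0r; lra.
rewrite sum_j; have := uE z; rewrite /= fp//.
under eq_bigr do rewrite fp// mulrDr mulrCA.
rewrite big_split /= -mulr_sumr -/s => uzE.
have -> : u z = u z + - a j z / a j z0 * u z0 - - a j z / a j z0 * u z0 by ring.
by rewrite uzE; field; apply: ltr0_neq0.
Qed.

Lemma farkas (R : realFieldType) (E : lmodType R) (I : finType)
    (a : I -> E -> R) (u : E -> R) :
  (forall i, scalar (a i)) -> scalar u ->
  (forall z, (forall i, 0 <= a i z) -> 0 <= u z) ->
  exists2 w : I -> R, forall i, 0 <= w i & forall z, u z = \sum_i w i * a i z.
Proof.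
move=> ha hu H; apply: (farkas_seq _ _ _ _ _ _ (index_enum_uniq I)) => // z az.
by apply: H => i; exact: az (mem_index_enum i).
Qed.

(** * The standard inner product on row vectors *)

Section dot_theory.
Context {R : realType} {n : nat}.
Implicit Types (x y z : 'rV[R]_n) (k : R).

Lemma dotC x y : dot x y = dot y x.
Proof. by apply: eq_bigr => i _; rewrite mulrC. Qed.

Lemma dotE x y : dot x y = (x *m y^T) 0 0.
Proof. by rewrite mxE; apply: eq_bigr => i _; rewrite mxE. Qed.

Lemma dotDr x y z : dot x (y + z) = dot x y + dot x z.
Proof. by rewrite -big_split; apply: eq_bigr => i _; rewrite mxE mulrDr. Qed.

Lemma dotZr x k y : dot x (k *: y) = k * dot x y.
Proof. by rewrite mulr_sumr; apply: eq_bigr => i _; rewrite mxE mulrCA. Qed.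

Lemma dotDl x y z : dot (x + y) z = dot x z + dot y z.
Proof. by rewrite ![dot _ z]dotC dotDr. Qed.

Lemma dotZl k x y : dot (k *: x) y = k * dot x y.
Proof. by rewrite ![dot _ y]dotC dotZr. Qed.

Lemma dot0r x : dot x 0 = 0.
Proof. by rewrite -(scale0r 0) dotZr mul0r. Qed.

Lemma dotNr x y : dot x (- y) = - dot x y.
Proof. by rewrite -scaleN1r dotZr mulN1r. Qed.

Lemma dotNl x y : dot (- x) y = - dot x y.
Proof. by rewrite dotC dotNr dotC. Qed.

Lemma dot_suml (I : finType) (f : I -> 'rV[R]_n) y :
  dot (\sum_i f i) y = \sum_i dot (f i) y.
Proof.
apply: (big_morph (fun x => dot x y)) => [x z|]; first exact: dotDl.
by rewrite dotC dot0r.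
Qed.

End dot_theory.

Lemma dot_mulmx (R : realType) (m n : nat) (x : 'rV[R]_m) (A : 'M[R]_(m, n))
    (y : 'rV[R]_n) :
  dot (x *m A) y = dot x (y *m A^T).
Proof. by rewrite !dotE trmx_mul trmxK mulmxA. Qed.

Lemma dot_split (R : realType) (n1 n2 : nat) (x y : 'rV[R]_(n1 + n2)) :
  dot x y = dot (lsubmx x) (lsubmx y) + dot (rsubmx x) (rsubmx y).
Proof.
by rewrite /dot big_split_ord /=; congr (_ + _); apply: eq_bigr => i _; rewrite !mxE.
Qed.

(** * Lifting a functional on the first block to a vector orthogonal to [L] *)

(** Farkas' lemma on pairs [(l, t)]: the multipliers of the forms [a i] build the second block of
    [x], those of the equations of the row space of [B] correct [v] in the first, and that of
    [t >= 0] gives the slack in the last bound. *)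
Lemma farkas_slice (R : realType) (n1 n2 m p : nat) (c : 'rV[R]_(n1 + n2))
    (L : {vspace 'rV[R]_(n1 + n2)}) (a : 'I_m -> 'rV[R]_n2)
    (B : 'M[R]_(p, n1)) (v : 'rV[R]_n1) (d : R) :
  (forall l (t : R) z, l \in L -> 0 <= t -> z = l + t *: c -> (lsubmx z <= B)%MS ->
    (forall i, dot (a i) (rsubmx z) <= 0) -> dot v (lsubmx z) + d * t <= 0) ->
  exists x, [/\ forall l, l \in L -> dot x l = 0,
    forall y, (y <= B)%MS -> dot (lsubmx x) y = dot v y,
    forall y, (forall i, dot (a i) y <= 0) -> 0 <= dot (rsubmx x) y &
    dot x c <= - d].
Proof.
move=> H; pose Q := cokermx B.
pose E : lmodType R := (subvs_of L * R^o)%type.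
pose f (e : E) : 'rV[R]_(n1 + n2) := vsval e.1 + (e.2 : R) *: c.
have fP k e e' : f (k *: e + e') = k *: f e + f e'.
  rewrite /f -[(k *: e + e').1]/(k *: e.1 + e'.1).
  rewrite -[(k *: e + e').2]/(k * e.2 + e'.2) linearP /=.
  by rewrite scalerDl scalerDr -scalerA addrACA.
(* The equations defining the row space of [B] enter with both signs. *)
pose g (i : 'I_m + 'I_n1 * bool + unit) (e : E) : R := match i with
  | inl (inl i) => - dot (a i) (rsubmx (f e))
  | inl (inr (j, b)) => (-1) ^+ b * (lsubmx (f e) *m Q) 0 j
  | inr tt => e.2 end.
have g_scalar i : scalar (g i).
  case: i => [[i|[j b]]|[]] k e e' //=; rewrite fP linearP.
    by rewrite /= dotDr dotZr opprD mulrN.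
  by rewrite /= mulmxDl -scalemxAl !mxE mulrDr mulrCA.
have [||w w_ge0 uE] := @farkas R E _ g
    (fun e => - (dot v (lsubmx (f e)) + d * e.2)) g_scalar.
- move=> k e e' /=; rewrite fP linearP /= dotDr dotZr.
  by rewrite -[k *: (e.2 : R^o)]/(k * e.2); ring.
- move=> e ge; rewrite oppr_ge0; apply: (H (vsval e.1) _ (f e)) => //.
  + exact: subvsP.
  + exact: ge (inr tt).
  + rewrite submxE; apply/eqP/rowP => j; rewrite [RHS]mxE.
    have := ge (inl (inr (j, true))); have := ge (inl (inr (j, false))).
    by rewrite /= expr0 expr1; lra.
  + by move=> i; have := ge (inl (inl i)); rewrite /= oppr_ge0.
pose q := \row_j (w (inl (inr (j, false))) - w (inl (inr (j, true)))).
(* The signs are such that the Farkas identity reads [dot x (l + t *: c) = - (d + w) * t], with [w]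
   the multiplier of [t]; then [t = 0] gives orthogonality to [L], and [l = 0], [t = 1] the bound at
   [c]. *)
pose x := row_mx (v + q *m Q^T) (- \sum_i w (inl (inl i)) *: a i).
have dot_q y : dot (q *m Q^T) y = \sum_j q 0 j * (y *m Q) 0 j.
  by rewrite dot_mulmx trmxK.
have xE (l : subvs_of L) (t : R) :
    dot x (vsval l + t *: c) = - ((d + w (inr tt)) * t).
  pose e : E := (l, t); rewrite -[_ + _]/(f e) -[t]/(e.2).
  pose F j b := w (inl (inr (j, b))) * ((-1) ^+ b * (lsubmx (f e) *m Q) 0 j).
  have := uE e; rewrite !big_sumType /= (big_pred1 tt) /=; last by case.
  rewrite [X in _ + X + _](eq_bigr (fun p => F p.1 p.2)); last by case.
  rewrite -(pair_bigA _ F) /= dot_split row_mxKl row_mxKr dotDl dot_q.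
  rewrite dotNl dot_suml.
  set s1 := \sum_i _; set s2 := \sum_i _; set s3 := \sum_i _.
  set s4 := \sum_i _.
  have -> : s1 = - s4.
    by rewrite -sumrN; apply: eq_bigr => i _; rewrite dotZl mulrN.
  have -> : s2 = s3.
    by apply: eq_bigr => j _; rewrite big_bool /F [q 0 j]mxE expr0 expr1 /=; ring.
  by move=> h; lra.
exists x; split.
- move=> l lL; have := xE (vsproj L l) 0.
  by rewrite vsprojK// scale0r addr0 mulr0 oppr0.
- move=> y; rewrite submxE => /eqP yQ.
  by rewrite row_mxKl dotDl dot_q yQ big1 ?addr0// => j _; rewrite [X in _ * X]mxE mulr0.
- move=> y ay; rewrite row_mxKr dotNl dot_suml -sumrN sumr_ge0// => i _.
  by rewrite dotZl -mulrN mulr_ge0// oppr_ge0.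
- have := xE 0 1; rewrite linear0 add0r scale1r => ->.
  by have := w_ge0 (inr tt); lra.
Qed.

(** * The M. Riesz extension theorem *)

(** Purely algebraic: a difference of closed cones can fail to be closed. *)
Definition convex_cone {R : realType} {E : lmodType R} (C : set E) : Prop :=
  [/\ C 0, forall x y, C x -> C y -> C (x + y) &
      forall (k : R) x, 0 <= k -> C x -> C (k *: x)].

Lemma cone_sum (R : realType) (E : lmodType R) (C : set E) (I : finType)
    (k : I -> R) (x : I -> E) :
  convex_cone C -> (forall i, 0 <= k i) -> (forall i, C (x i)) ->
  C (\sum_i k i *: x i).
Proof.
by move=> [C0 CD CZ] k_ge0 Cx; apply: (big_ind C) => // i _; apply: CZ.
Qed.

(* One step of the M. Riesz extension: [s] is the largest value on [y] allowed
   by [C] for a functional equal to 1 at [e], and the kernel direction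
   [y - s *: e] is adjoined to [C]. *)
Lemma cone_add_line (R : realType) (E : lmodType R) (C : set E) (e y : E) :
  convex_cone C -> ~ C (- e) ->
  (exists t, C (t *: e + y)) -> (exists t, C (t *: e - y)) ->
  exists C' s, [/\ convex_cone C', C `<=` C', ~ C' (- e),
                   C' (y - s *: e) & C' (s *: e - y)].
Proof.
move=> [C0 CD CZ] Ce [t0 Ct0] [t1 Ct1].
have noneg k : k < 0 -> ~ C (k *: e).
  move=> k0 /(CZ (- k^-1)); rewrite scalerA mulNr mulVf ?ltr0_neq0// scaleN1r.
  by move=> /(_ _)/Ce; apply; rewrite oppr_ge0 invr_le0 ltW.
pose S := [set t : R | C (y - t *: e)]; pose s := sup S.
have supS : has_sup S.
  split; first by exists (- t0); rewrite /S /= scaleNr opprK addrC.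
  (* If [t > t1], adding [t1 *: e - y] and [y - t *: e] puts a negative multiple of [e] in [C]. *)
  exists t1 => t St; rewrite leNgt; apply/negP => t1t.
  apply: (noneg (t1 - t)); first by lra.
  by have := CD _ _ Ct1 St; rewrite addrA subrK scalerBl.
exists [set x | exists2 z, C z & exists r, x = z + r *: (y - s *: e)], s; split.
- split.
  + by exists 0 => //; exists 0; rewrite scale0r addr0.
  + move=> _ _ [x Cx [r ->]] [x' Cx' [r' ->]].
    by exists (x + x'); [exact: CD|exists (r + r'); rewrite scalerDl addrACA].
  + move=> k _ k0 [x Cx [r ->]].
    by exists (k *: x); [exact: CZ|exists (k * r); rewrite scalerDr scalerA].
- by move=> x Cx; exists x => //; exists 0; rewrite scale0r addr0.
- move=> [z Cz [r]].
  have [r0|r0|->] := ltgtP r 0; last first.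
  + by rewrite scale0r addr0 => ez; apply: Ce; rewrite ez.
  (* For [r > 0], an element of [S] within [r^-1] of the supremum again yields a negative multiple
     of [e] in [C]. *)
  + move=> /(canLR (addrK _)) zE.
    have [t St st] := sup_adherent (eps := r^-1) ltac:(by rewrite invr_gt0) supS.
    apply: (noneg (s - r^-1 - t)); first by rewrite -/s in st; lra.
    suff -> : (s - r^-1 - t) *: e = r^-1 *: z + (y - t *: e).
      by apply: CD => //; apply: CZ => //; rewrite invr_ge0 ltW.
    rewrite -zE scalerBr scalerN scalerA mulVf ?gt_eqF// scale1r opprB !scalerBl.
    by rewrite -[RHS]addrA subrKA addrA [- _ + _]addrC.
  (* For [r < 0], the number [s - r^-1] lies in [S] and exceeds its supremum. *)
  + move=> /(canLR (addrK _)) zE.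
    have Sr : S (s - r^-1).
      rewrite /S /=; suff -> : y - (s - r^-1) *: e = - r^-1 *: z.
        by apply: CZ => //; rewrite oppr_ge0 invr_le0 ltW.
      rewrite -zE scalerBr scalerN !scaleNr !opprK scalerA mulVf ?lt_eqF//.
      by rewrite scale1r scalerBl opprB addrCA.
    have := sup_upper_bound supS Sr; rewrite -/s gerDl oppr_le0 invr_ge0.
    by rewrite leNgt r0.
- by exists 0 => //; exists 1; rewrite scale1r add0r.
- by exists 0 => //; exists (-1); rewrite scaleN1r add0r opprB.
Qed.

Lemma cone_add_lines (R : realType) (E : lmodType R) (C : set E) (e : E)
    (ys : seq E) :
  convex_cone C -> ~ C (- e) ->
  (forall y, y \in ys ->
    (exists t, C (t *: e + y)) /\ (exists t, C (t *: e - y))) ->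
  exists C', [/\ convex_cone C', C `<=` C', ~ C' (- e) &
    forall y, y \in ys -> exists s, C' (y - s *: e) /\ C' (s *: e - y)].
Proof.
elim: ys C => [|y ys IHys] C hC Ce H; first by exists C; split.
have [[t0 Ct0] [t1 Ct1]] := H y (mem_head _ _).
have [//|//|||C1 [s [hC1 CC1 C1e C1y C1y']]] := cone_add_line _ _ C e y.
- by exists t0.
- by exists t1.
have [//|//||C' [hC' C1C' C'e C'ys]] := IHys C1.
  move=> z zys; have [] := H z; first by rewrite inE zys orbT.
  by move=> [u Cu] [u' Cu']; split; [exists u|exists u']; apply: CC1.
exists C'; split=> //; first by move=> x /CC1/C1C'.
move=> z; rewrite inE => /predU1P[->|/C'ys//].
by exists s; split; exact: C1C'.
Qed.

(** Once the lines of all rows of [B] are adjoined, the enlarged cone contains [y - dot v y *: e]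
    for every [y] in the row space, while it contains [k *: e] only for [k >= 0]. *)
Lemma riesz_extension (R : realType) (n m : nat) (C : set 'rV[R]_n)
    (B : 'M[R]_(m, n)) (e : 'rV[R]_n) :
  convex_cone C -> ~ C (- e) -> (e <= B)%MS ->
  (forall y, (y <= B)%MS -> exists t, C (t *: e + y)) ->
  exists v, dot v e = 1 /\ forall y, (y <= B)%MS -> C y -> 0 <= dot v y.
Proof.
move=> hC Ce eB H.
have [//|//||C' [[C'0 C'D C'Z] CC' C'e]] :=
    cone_add_lines _ _ C e [seq row i B | i <- enum 'I_m].
  move=> _ /mapP[i _ ->]; split; apply: H; first exact: row_sub.
  by rewrite eqmx_opp row_sub.
move=> lineP; have [s sP] :=
  choice (fun i => lineP _ (map_f (fun i => row i B) (mem_enum 'I_m i))).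
(* The rows of [B] may be dependent; [pinvmx B] selects coordinates linearly. *)
pose v := (\row_i s i) *m (pinvmx B)^T; exists v.
have vE y : dot v y = \sum_i s i * (y *m pinvmx B) 0 i.
  by rewrite dot_mulmx trmxK; apply: eq_bigr => i _; rewrite mxE.
have ker y : (y <= B)%MS -> C' (y - dot v y *: e).
  move=> yB.
  have -> : y - dot v y *: e =
      \sum_i (y *m pinvmx B) 0 i *: (row i B - s i *: e).
    rewrite vE scaler_suml -[X in X - _](mulmxKpV yB) mulmx_sum_row -sumrB.
    by apply: eq_bigr => i _; rewrite scalerBr scalerA [s i * _]mulrC.
  apply: (big_ind C') => // i _; have [Cs Cs'] := sP i.
  have [k0|k0] := leP 0 ((y *m pinvmx B) 0 i); first exact: C'Z.
  by rewrite -opprB scalerN -scaleNr; apply: C'Z => //; rewrite oppr_ge0 ltW.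
have pos k : C' (k *: e) -> 0 <= k.
  move=> Cke; rewrite leNgt; apply/negP => k0; apply: C'e.
  have := C'Z (- k^-1) _ _ Cke.
  rewrite scalerA mulNr mulVf ?ltr0_neq0// scaleN1r; apply.
  by rewrite oppr_ge0 invr_le0 ltW.
split=> [|y yB Cy].
- have := ker _ eB; have NeB : (- e <= B)%MS by rewrite eqmx_opp.
  have := ker _ NeB; rewrite dotNr scaleNr opprK addrC.
  have -> : e - dot v e *: e = (1 - dot v e) *: e by rewrite scalerBl scale1r.
  have -> : dot v e *: e - e = (dot v e - 1) *: e by rewrite scalerBl scale1r.
  by move=> /pos h1 /pos h2; lra.
- apply: pos; have NyB : (- y <= B)%MS by rewrite eqmx_opp.
  have := C'D _ _ (ker _ NyB) (CC' _ Cy).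
  by rewrite dotNr scaleNr opprK addrAC addNr add0r.
Qed.

(** * Closed cones, polyhedral cones and spanning families *)

Lemma closed_convex_cone_cone (R : realType) (n : nat) (K : set 'rV[R]_n) :
  closed_convex_cone K -> convex_cone K.
Proof.
move=> [[x0 Kx0] _ convK KZ]; split.
- by rewrite -(scale0r x0); exact: KZ.
(* The sum is twice the midpoint. *)
- move=> x y Kx Ky; pose h := @Itv01 R 2^-1 ltac:(lra) ltac:(lra).
  have := convK x y h (mem_set Kx) (mem_set Ky).
  move=> /set_mem/(KZ 2 _ (ler0n _ _)); congr (K _).
  rewrite /conv /= scalerDr !scalerA /unstable.onem.
  rewrite divff//; have -> : 2 * (1 - 2^-1) = 1 :> R by lra.
  by rewrite !scale1r.
- by move=> k x; exact: KZ.
Qed.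

(** The bounds are nonnegative because 0 lies in [K], and a positive value of some [dot (a i)] could
    be scaled beyond its bound. *)
Lemma polyhedral_cone (R : realType) (n : nat) (K : set 'rV[R]_n) :
  convex_cone K -> polyhedral K -> exists m (a : 'I_m -> 'rV[R]_n),
    forall x, K x <-> forall i, dot (a i) x <= 0.
Proof.
move=> [K0 _ KZ] [m [a [b KE]]]; exists m, a => x.
have b_ge0 i : 0 <= b i by move: K0; rewrite KE => /(_ i); rewrite dot0r.
split=> [Kx i|ax]; last by rewrite KE => i; exact: le_trans (ax i) (b_ge0 i).
rewrite leNgt; apply/negP => d_gt0.
have := KZ ((b i + 1) / dot (a i) x) x; rewrite divr_ge0 ?ltW//; last first.
  by have := b_ge0 i; lra.
move=> /(_ isT Kx); rewrite KE => /(_ i); rewrite dotZr divfK ?gt_eqF//.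
by lra.
Qed.

(** A family in [K] of maximal rank spans [K], since appending an element cannot raise the rank. *)
Lemma spanning_rows (R : fieldType) (n : nat) (K : set 'rV[R]_n) :
  exists m (B : 'M[R]_(m, n)),
    (forall i, K (row i B)) /\ forall x, K x -> (x <= B)%MS.
Proof.
pose P r := `[< exists m (B : 'M[R]_(m, n)),
  (forall i, K (row i B)) /\ \rank B = r >].
have P0 : exists r, P r.
  by exists 0%N; apply/asboolP; exists 0%N, 0; split; [case|rewrite mxrank0].
have Pn r : P r -> (r <= n)%N.
  by move=> /asboolP[m [B [_ <-]]]; exact: rank_leq_col.
case: (ex_maxnP P0 Pn) => r /asboolP[m [B [KB rB]]] rmax.
exists m, B; split=> // x Kx.
have sB : (B <= col_mx B x)%MS by rewrite -addsmxE addsmxSl.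
apply: (@submx_trans _ _ _ _ _ _ (col_mx B x)); first by rewrite -addsmxE addsmxSr.
rewrite -(mxrank_leqif_sup sB) eqn_leq mxrankS//= rB; apply: rmax.
apply/asboolP; exists (m + 1)%N, (col_mx B x); split=> // i.
by case: (split_ordP i) => j ->; rewrite ?rowKu// rowKd row_id.
Qed.

(** * Order units and the relative interior *)

Section cone_generators.
Context {R : realType} {n m : nat} (K : set 'rV[R]_n) (B : 'M[R]_(m, n)).
Hypotheses (hK : convex_cone K) (KB : forall i, K (row i B)).

Let e := \sum_i row i B.

Let shift_eE t y : (y <= B)%MS ->
  t *: e + y = \sum_i (t + (y *m pinvmx B) 0 i) *: row i B.
Proof.
move=> yB; rewrite -[in LHS](mulmxKpV yB) mulmx_sum_row scaler_sumr -big_split.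
by apply: eq_bigr => i _; rewrite scalerDl.
Qed.

Lemma sum_rows_sub : (e <= B)%MS.
Proof. by apply: summx_sub => i _; exact: row_sub. Qed.

Lemma cone_order_unit y : (y <= B)%MS -> exists2 t, 0 <= t & K (t *: e + y).
Proof.
move=> yB; exists (\sum_i `|(y *m pinvmx B) 0 i|); first exact: sumr_ge0.
rewrite shift_eE//; apply: (cone_sum _ _ _ _ _ _ hK) => // i.
rewrite (bigD1 i)//=; set s := \sum_(_ < _ | _) _.
have s_ge0 : 0 <= s by exact: sumr_ge0.
by have := ler_norm (- (y *m pinvmx B) 0 i); rewrite normrN; lra.
Qed.

(** Subtracting [eps *: e] leaves a slack of [eps] in each coordinate along the rows of [B], which
    absorbs small perturbations within the span. *)
Lemma relint_sub_sum_rows (eps : R) x : (forall y, K y -> (y <= B)%MS) ->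
  0 < eps -> K (x - eps *: e) -> relint K x.
Proof.
move=> KsubB eps0 Kx; have [_ KD _] := hK; pose P := pinvmx B.
have nearK y : (y <= B)%MS -> (forall i, `|(y *m P) 0 i| <= eps) -> K (x + y).
  move=> yB Py; rewrite -[x](subrK (eps *: e)) -addrA; apply: KD => //.
  rewrite shift_eE//; apply: (cone_sum _ _ _ _ _ _ hK) => // i.
  by have := Py i; rewrite ler_norml; lra.
have xB : (x <= B)%MS.
  by rewrite -[x](subrK (eps *: e)) addmx_sub ?scalemx_sub ?sum_rows_sub ?KsubB.
split.
  rewrite -[x]addr0; apply: nearK => [|i]; first exact: sub0mx.
  by rewrite mul0mx mxE normr0 ltW.
(* [S] bounds the absolute column sums of [P], so a sup-norm perturbation below [eps / S] has
   coordinates at most [eps]; the 1 keeps [S] positive. *)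
pose S := 1 + \sum_i \sum_j `|P j i|.
have S_gt0 : 0 < S by rewrite ltr_pwDl// sumr_ge0// => i _; exact: sumr_ge0.
apply/nbhs_ballP; exists (eps / S) => /=; first exact: divr_gt0.
move=> z [_ xz] [l [k [q [_ Kq zE]]]].
have zB : (z <= B)%MS.
  by rewrite zE; apply: summx_sub => i _; apply: scalemx_sub; exact: KsubB.
rewrite -[z](subrK x) addrC; apply: nearK => [|i].
  by rewrite addmx_sub// eqmx_opp.
have -> : eps = eps / S * S by rewrite divfK// gt_eqF.
rewrite mxE (le_trans (ler_norm_sum _ _ _))//.
apply: (@le_trans _ _ (eps / S * \sum_j `|P j i|)).
  rewrite mulr_sumr; apply: ler_sum => j _; rewrite normrM ler_wpM2r//.
  by rewrite !mxE distrC; exact: ltW (xz 0 j).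
rewrite ler_wpM2l//; first by rewrite ltW// divr_gt0.
rewrite /S (bigD1 i)//= addrCA lerDl addr_ge0// sumr_ge0// => l' _.
exact: sumr_ge0.
Qed.

End cone_generators.

Lemma relint_prolong (R : realType) (n : nat) (K : set 'rV[R]_n) x y :
  relint K x -> K y -> exists2 d : R, 0 < d & K (x + d *: (x - y)).
Proof.
move=> [Kx /nbhs_normP[eps /= eps0 epsK]] Ky.
(* The 1 covers [x = y]. *)
pose d := eps / (`|x - y| + 1).
have d_gt0 : 0 < d by rewrite divr_gt0// ltr_wpDl.
exists d => //; apply: epsK => /=.
  rewrite opprD addNKr normrN normrZ gtr0_norm// /d mulrAC ltr_pdivrMr ?ltr_wpDl//.
  by rewrite ltr_pM2l// ltrDl.
exists 2%N, (fun i => if i == 0 then 1 + d else - d).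
exists (fun i => if i == 0 then x else y); split.
- by rewrite big_ord_recl big_ord1 /=; lra.
- by move=> i; case: ifP.
- by rewrite big_ord_recl big_ord1 /= scalerDl scale1r scalerBr scaleNr addrA.
Qed.

(** * The alternative for the product cone *)

Theorem theorem4 (R : realType) (n1 n2 : nat)
    (c : 'rV[R]_(n1 + n2)) (L : {vspace 'rV[R]_(n1 + n2)})
    (K1 : set 'rV[R]_n1) (K2 : set 'rV[R]_n2) (K : set 'rV[R]_(n1 + n2))
    (hK1 : closed_convex_cone K1) (hK2 : closed_convex_cone K2)
    (hK : K = prod_set K1 K2) (hpoly : polyhedral K2) :
  [set l + c | l in [set` L]] `&` prod_set (relint K1) K2 = set0 <->
  (exists x, (dual_cone K `&` orth [set` L]) x /\ dot c x < 0) \/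
  (exists x, (dual_cone K `&` orth [set` L] `&` orth [set c]) x /\
             ~ orth K1 (lsubmx x)).
Proof.
have cone1 := closed_convex_cone_cone _ _ _ hK1.
have cone2 := closed_convex_cone_cone _ _ _ hK2.
have [K1_0 K1D K1Z] := cone1; have [K2_0 K2D K2Z] := cone2.
split; last first.
  move=> sep; apply/seteqP; split=> // _ [[l lL <-] [ri_z1 K2_z2]].
  case: sep => -[x].
    move=> [[Kx Lx] cx]; have := Kx (l + c).
    rewrite hK dotDr Lx// add0r dotC leNgt cx => /(_ _)/negP; apply => //.
    by split=> //; case: ri_z1.
  move=> [[[Kx Lx] cx]]; apply => y K1y.
  (* Vectors with one zero block test the two blocks of [x] separately. *)
  have x1_ge0 y1 : K1 y1 -> 0 <= dot (lsubmx x) y1.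
    move=> K1y1; have := Kx (row_mx y1 0); rewrite dot_split row_mxKl row_mxKr.
    by rewrite dot0r addr0; apply; rewrite hK /prod_set /= row_mxKl row_mxKr.
  have x2_ge0 : 0 <= dot (rsubmx x) (rsubmx (l + c)).
    have := Kx (row_mx 0 (rsubmx (l + c))); rewrite dot_split row_mxKl row_mxKr.
    by rewrite dot0r add0r; apply; rewrite hK /prod_set /= row_mxKl row_mxKr.
  have z1_ge0 := x1_ge0 _ ri_z1.1.
  have : dot x (l + c) = 0 by rewrite dotDr Lx// cx// addr0.
  rewrite dot_split => xz; have z1_eq0 : dot (lsubmx x) (lsubmx (l + c)) = 0 by lra.
  (* Prolonging the segment from [y] beyond the relative interior point, where [x1] vanishes, forces
     [x1] to be nonpositive at [y]. *)
  have [d d_gt0 /x1_ge0] := relint_prolong _ _ _ _ _ ri_z1 K1y.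
  rewrite dotDr dotZr dotDr dotNr z1_eq0 !add0r pmulr_rge0// oppr_ge0 => xy.
  by apply/eqP; rewrite eq_le xy x1_ge0.
move=> disj.
have [p [B [KB K1B]]] := spanning_rows _ _ K1.
have [m [a K2E]] := polyhedral_cone _ _ _ cone2 hpoly.
pose e := \sum_i row i B.
have K1e : K1 e by apply: (big_ind K1).
have eB : (e <= B)%MS := sum_rows_sub _.
have ri eps x : 0 < eps -> K1 (x - eps *: e) -> relint K1 x.
  exact: (relint_sub_sum_rows _ _ cone1 KB).
have dualK x : (forall y, K1 y -> 0 <= dot (lsubmx x) y) ->
    (forall y, (forall i, dot (a i) y <= 0) -> 0 <= dot (rsubmx x) y) ->
    dual_cone K x.
  move=> x1 x2 z; rewrite hK => -[K1z K2z]; rewrite dot_split addr_ge0 ?x1//.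
  by apply: x2; exact/K2E.
have [[q [[lq lqL qE] qB K2q]]|noQ] := pselect (exists z,
    [/\ exists2 l, l \in L & z = l + c, (lsubmx z <= B)%MS & K2 (rsubmx z)]);
  last first.
  (* With [v = 0] and [d = 1] the hypothesis says [t <= 0]: a positive [t] would rescale to a point
     of the empty slice. The resulting [x1] vanishes on [K1], and [dot x c <= -1]. *)
  have [|x [xL xB x2 xc]] := farkas_slice R n1 n2 m p c L a B 0 1.
    move=> l t z lL t_ge0 zE zB az; rewrite dotC dot0r add0r mul1r leNgt.
    apply/negP => t_gt0; apply: noQ; exists (t^-1 *: z); split.
    - exists (t^-1 *: l); first exact: memvZ.
      by rewrite zE scalerDr scalerA mulVf ?gt_eqF// scale1r.
    - by rewrite linearZ scalemx_sub.
    - by rewrite linearZ; apply: K2Z; [rewrite invr_ge0 ltW|exact/K2E].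
  left; exists x; split; last by rewrite dotC; lra.
  split=> //; apply: dualK => // y K1y.
  by rewrite xB ?K1B// dotC dot0r.
(* Allowing [t = 0] includes the recession directions of the slice. *)
pose H : set 'rV[R]_n1 := [set h | exists l (t : R),
  [/\ l \in L, 0 <= t, h = lsubmx (l + t *: c), (h <= B)%MS &
      K2 (rsubmx (l + t *: c))]].
have H0 : H 0.
  by exists 0, 0; rewrite mem0v scale0r addr0 !linear0 sub0mx; split.
have HD h h' : H h -> H h' -> H (h + h').
  move=> [l [t [lL t0 hE hB K2h]]] [l' [t' [lL' t0' hE' hB' K2h']]].
  have E : l + l' + (t + t') *: c = (l + t *: c) + (l' + t' *: c).
    by rewrite scalerDl addrACA.
  exists (l + l'), (t + t'); rewrite E.
  move: (l + _) (l' + _) hE K2h hE' K2h' => u u' hE K2h hE' K2h'.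
  rewrite !linearD /= -hE -hE'; split=> //.
  - exact: memvD.
  - exact: addr_ge0.
  - exact: addmx_sub.
  - exact: K2D.
have HZ k h : 0 <= k -> H h -> H (k *: h).
  move=> k0 [l [t [lL t0 hE hB K2h]]].
  have E : k *: l + (k * t) *: c = k *: (l + t *: c).
    by rewrite scalerDr scalerA.
  exists (k *: l), (k * t); rewrite E !linearZ /= -hE; split=> //.
  - exact: memvZ.
  - exact: mulr_ge0.
  - exact: scalemx_sub.
  - exact: K2Z.
pose C : set 'rV[R]_n1 := [set y | exists k h, [/\ K1 k, H h & y = k - h]].
have coneC : convex_cone C.
  split.
  - by exists 0, 0; rewrite subr0.
  - move=> _ _ [k [h [K1k Hh ->]]] [k' [h' [K1k' Hh' ->]]].
    by exists (k + k'), (h + h'); rewrite opprD addrACA; split; auto.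
  - move=> r _ r0 [k [h [K1k Hh ->]]].
    by exists (r *: k), (r *: h); rewrite scalerBr; split; auto.
have not_disj l : l \in L -> relint K1 (lsubmx (l + c)) -> K2 (rsubmx (l + c)) ->
    False.
  by move=> lL ri1 K2l; rewrite -[False]/(set0 (l + c)) -disj; split=> //; exists l.
have CNe : ~ C (- e).
  move=> [k [h [K1k [l [t [lL t_ge0 hE hB K2h]]]]]].
  move=> ek; have hE' : e + k = h by rewrite -[e]opprK ek opprB subrK.
  have : 0 <= t by []; rewrite le_eqVlt => /predU1P[t0|t_gt0].
    (* [l] is a recession direction of the nonempty slice through [q], and
       following it far enough leads into the relative interior of [K1]. *)
    rewrite -t0 scale0r addr0 in hE K2h.
    have [s s_ge0 K1s] := cone_order_unit _ _ cone1 KB _ qB.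
    (* In the step length [s + 1], [s] copies of [e] bring [q] into [K1] and one more is the margin
       for the relative interior. *)
    have E : lq + (s + 1) *: l + c = q + (s + 1) *: l by rewrite qE addrAC.
    apply: (not_disj (lq + (s + 1) *: l)); first by rewrite memvD// memvZ.
    - rewrite E linearD linearZ /= -hE -hE'; apply: (ri 1) => //; rewrite scale1r.
      have -> : lsubmx q + (s + 1) *: (e + k) - e =
          s *: e + lsubmx q + (s + 1) *: k.
        rewrite scalerDr [(s + 1) *: e]scalerDl scale1r !addrA addrAC.
        by rewrite addrK [s *: e + _]addrC.
      by apply: K1D => //; apply: K1Z => //; lra.
    - by rewrite E linearD linearZ; apply: K2D => //; apply: K2Z => //; lra.
  (* For [t > 0], rescaling by [t^-1] lands in [L + c], with margin [t^-1 *: e]. *)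
  have E : t^-1 *: l + c = t^-1 *: (l + t *: c).
    by rewrite scalerDr scalerA mulVf ?gt_eqF// scale1r.
  apply: (not_disj (t^-1 *: l)); first exact: memvZ.
  - rewrite E linearZ /= -hE -hE'; apply: (ri t^-1); first by rewrite invr_gt0.
    by rewrite scalerDr addrAC subrr add0r; apply: K1Z => //; rewrite invr_ge0.
  - by rewrite E linearZ; apply: K2Z => //; rewrite invr_ge0.
have [y yB|v [ve vC]] := riesz_extension _ _ _ C B e coneC CNe eB.
  have [t _ K1t] := cone_order_unit _ _ cone1 KB _ yB.
  by exists t, (t *: e + y), 0; rewrite subr0.
have v_ge0 y : K1 y -> 0 <= dot v y.
  by move=> K1y; apply: vC; [exact: K1B|exists y, 0; rewrite subr0].
(* Here [d = 0]: [v] is nonpositive on [H] because [- H] lies in [C]. *)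
have [|x [xL xB x2 xc]] := farkas_slice R n1 n2 m p c L a B v 0.
  move=> l t z lL t_ge0 zE zB az; rewrite mul0r addr0 -oppr_ge0 -dotNr.
  apply: vC; first by rewrite eqmx_opp.
  exists 0, (lsubmx z); rewrite sub0r; split=> //.
  by exists l, t; rewrite -zE; split=> //; exact/K2E.
have Kx : dual_cone K x by apply: dualK => // y K1y; rewrite xB ?v_ge0 ?K1B.
move: xc; rewrite oppr0 le_eqVlt => /predU1P[xc|xc]; last first.
  by left; exists x; rewrite dotC.
right; exists x; split; first by split=> // y ->.
(* The witness is [e], where [x1] takes the value [dot v e = 1]. *)
by move=> /(_ e K1e); rewrite xB// ve; apply/eqP; exact: oner_neq0.
Qed.
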